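(* There is a valid $(m, 1)$ protocol to determine if a (directed) graph is a DAG.
   Context: Setting (annotation model): a verifier $\mathcal{V}$ with a private random string and small working memory, and a deterministic helper $\mathcal{H}$, both observe a data stream $\mathcal{A}$ of $m$ directed edges of a graph $G=(V,E)$ on $n$ nodes; after the stream ends, $\mathcal{H}$ sends an annotation $h(\mathcal{A})$, which $\mathcal{V}$ also reads as a stream. $\mathcal{V}$ may output $\perp$ if unconvinced. A protocol is valid if (1) there is at least one helper whose annotation makes $\mathcal{V}$ output the correct answer with probability 1 on every stream, and (2) for every helper and every stream, either that helper's annotation is valid for the stream or $\mathcal{V}$ outputs something other than $\perp$ with probability at most $1/3$. An $(h,v)$ protocol is a valid protocol with annotation length $O(h+1)$ and verifier working memory $O(v+1)$, measured in machine words of $\Theta(\log m)$ bits.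
   Formalization: The formal statement adds that the name of a node fits in a machine word of Θ(log m) bits, i.e. n ≤ 2^(word length), so n is polynomially bounded in m; for unbounded n (already at m = 2) no such protocol exists. *)

(* Defs.v *)
From mathcomp Require Import all_boot all_order all_algebra.
From mathcomp Require Import boolp.

Set Implicit Arguments.
Unset Strict Implicit.
Unset Printing Implicit Defensive.

Import GRing.Theory Num.Theory.

(* Uniform probability of an event on a finite sample space. *)
Definition prob (Omega : finType) (E : pred Omega) : rat :=
  (#|E|%:R / #|Omega|%:R)%R.

Definition word (b : nat) : Type := b.-tuple bool.

(* [T] is the type of stream tokens, [A] the type of answers, [b] the number of
   bits of a machine word.  The private random string is read once, in blocks
   of [coins] bits: one block to initialise the memory and one for each item
   read.  Everything retained between two items, including past random bits,
   is therefore part of the working memory of [mem_words] words.  The output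
   [None] stands for "unconvinced". *)
Record verifier (T A : Type) (b : nat) := Verifier {
  mem_words : nat;
  coins : nat;
  init : coins.-tuple bool -> mem_words.-tuple (word b);
  (* [inl] is a token of the data stream, [inr] a word of the annotation *)
  step : coins.-tuple bool -> T + word b ->
         mem_words.-tuple (word b) -> mem_words.-tuple (word b);
  output : mem_words.-tuple (word b) -> option A
}.

Section Protocol.
Variables (T : Type) (A : eqType) (b : nat) (V : verifier T A b).

Definition transcript (s : seq T) (a : seq (word b)) : seq (T + word b) :=
  map inl s ++ map inr a.

Definition random_string (s : seq T) (a : seq (word b)) : finType :=
  ((coins V).-tuple bool *
   (size (transcript s a)).-tuple ((coins V).-tuple bool))%type.

Definition run (s : seq T) (a : seq (word b)) (r : random_string s a) :
    option A :=
  output (foldl (fun x p => step p.1 p.2 x) (init r.1)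
                (zip r.2 (transcript s a))).

Variables (m : nat) (f : m.-tuple T -> A).

Definition valid_annotation (s : m.-tuple T) (a : seq (word b)) : Prop :=
  prob (fun r : random_string s a => run r == Some (f s)) = 1%R.

(* A helper is deterministic and does not see the random string. *)
Definition helper : Type := m.-tuple T -> seq (word b).

Definition valid_helper (H : helper) : Prop :=
  forall s : m.-tuple T, valid_annotation s (H s).

Definition sound : Prop :=
  forall (H : helper) (s : m.-tuple T),
    valid_annotation s (H s) \/
    (prob (fun r : random_string s (H s) => run r != None) <= 1 / 3%:R)%R.

Definition valid_protocol (len : nat) : Prop :=
  (exists2 H : helper, valid_helper H & forall s, size (H s) <= len) /\ sound.

End Protocol.

Definition edge (n : nat) : Type := ('I_n * 'I_n)%type.

(* [w m = Theta(log m)]; the shift by 2 makes the bounds meaningful (and the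
   words nonempty) for every [m]. *)
Definition theta_log (w : nat -> nat) : Prop :=
  exists c1 c2 : nat, forall m,
    trunc_log 2 m.+2 <= c1 * w m /\ w m <= c2 * trunc_log 2 m.+2.

(* [P n m] treats streams of [m] directed edges on [n] nodes with words of
   [w m] bits.  The condition [n <= 2 ^ w m] says that the name of a node fits
   in a machine word, i.e. that [log n = O(log m)].  The constant [C] of the
   two bounds does not depend on [n] and [m]. *)
Definition hv_protocol (A : eqType) (w : nat -> nat)
    (f : forall n, seq (edge n) -> A) (h v : nat -> nat -> nat)
    (P : forall n m, verifier (edge n) A (w m)) : Prop :=
  exists C : nat, forall n m, n <= 2 ^ w m ->
    mem_words (P n m) <= C * (v n m + 1) /\
    valid_protocol (P n m) (fun s : m.-tuple (edge n) => f n s)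
      (C * (h n m + 1)).

Definition acyclic (T : eqType) (e : rel T) : Prop :=
  forall c : seq T, ucycle e c -> c = [::].

Definition stream_graph (n : nat) (s : seq (edge n)) : rel 'I_n :=
  fun x y => (x, y) \in s.

Definition is_dag (n : nat) (s : seq (edge n)) : bool :=
  `[< acyclic (stream_graph s) >].

(* Main.v *)
Require Import Defs.
From mathcomp Require Import all_boot all_order all_algebra all_field.
From mathcomp Require Import boolp.
From mathcomp Require Import zify.

(* The annotation consists of [m] chunks.  A chunk is an edge [(u, v)] with
   claimed ranks of its endpoints, and two further pairs (vertex, rank).  The
   edges must be a permutation of the stream, and the further pairs a
   permutation of the claimed (vertex, rank) pairs, listed by increasing vertex,
   so that comparing neighbours shows that each vertex has a single rank.  If
   moreover all edges increase the rank, the graph is acyclic; if on the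
   contrary the listed edges start with a closed walk, it is not.  All these
   checks take constantly many words, except for the two permutations, which
   are replaced by one comparison of tagged multisets: each multiset [s] is
   evaluated as the product of [x - y], [y] in [s], at a random point [x] of the
   field with [2 ^ k] elements.  Distinct multisets of size at most [3 * m]
   collide at no more than [3 * m <= 2 ^ k / 3] points. *)

Set Implicit Arguments.
Unset Strict Implicit.
Unset Printing Implicit Defensive.

Import GRing.Theory Num.Theory.

(** * Encodings of finite types and uniform probability *)

Lemma exists_injective (S T : finType) :
  #|S| <= #|T| -> exists f : S -> T, injective f.
Proof.
move=> leST; have ltT x : enum_rank x < #|T| := leq_trans (ltn_ord _) leST.
exists (fun x : S => enum_val (Ordinal (ltT x))) => x y /enum_val_inj[].
by move/val_inj/enum_rank_inj.
Qed.

Lemma injective_cancel (S T : finType) (s0 : S) (f : S -> T) :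
  injective f -> exists g, cancel f g.
Proof.
move=> f_inj; exists (fun y => odflt s0 [pick x | f x == y]) => x.
by case: pickP => [y /eqP /f_inj //|/(_ x)]; rewrite eqxx.
Qed.

Lemma prob_fst (S T : finType) (p : pred S) :
  0 < #|T| -> prob (fun r : S * T => p r.1) = prob p.
Proof.
move=> T0; rewrite /prob card_prod.
have -> : #|(fun r : S * T => p r.1)| = #|p| * #|T|.
  by rewrite -(cardX p predT); apply: eq_card => r; rewrite !inE andbT.
by rewrite !natrM -mulf_div divff ?mulr1 // pnatr_eq0 -lt0n.
Qed.

Lemma prob_inj (S T : finType) (g : S -> T) (p : pred T) :
  injective g -> #|T| = #|S| -> prob (fun x => p (g x)) = prob p.
Proof.
move=> g_inj cTS; rewrite /prob -cTS; congr (_%:R / _)%R.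
have [h gK hK] := inj_card_bij g_inj (eq_leq cTS).
rewrite -(card_image g_inj); apply: eq_card => y.
apply/imageP/idP => [[x px ->] //|py].
by exists (h y); rewrite ?unfold_in /= hK.
Qed.

(** * Fingerprints of multisets over a finite field *)

Section Fingerprint.
Variables (F : finFieldType) (X : finType) (code : X -> F).
Hypothesis code_inj : injective code.

Definition fingerprint (x : F) (s : seq X) : F :=
  (\prod_(y <- s) (x - code y))%R.

Lemma fingerprint_cat x s t :
  fingerprint x (s ++ t) = (fingerprint x s * fingerprint x t)%R.
Proof. exact: big_cat. Qed.

Lemma perm_fingerprint x s t :
  perm_eq s t -> fingerprint x s = fingerprint x t.
Proof. by move=> st; apply: perm_big. Qed.

(** A collision point is a root of the difference of two products of monic linear factors. Unique
    factorisation makes the difference nonzero, and its degree is at most the larger size. *)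
Lemma fingerprint_collisions s t : ~~ perm_eq s t ->
  #|[pred x | fingerprint x s == fingerprint x t]| <= maxn (size s) (size t).
Proof.
move=> nst; pose P u := (\prod_(y <- map code u) ('X - y%:P))%R.
have sP u : size (P u) = (size u).+1 by rewrite size_prod_XsubC size_map.
have hP u x : (P u).[x]%R = fingerprint x u.
  rewrite horner_prod big_map; apply: eq_bigr => y _.
  by rewrite hornerXsubC.
have PQ0 : (P s - P t != 0)%R.
  apply: contra nst; rewrite subr_eq0 => /eqP /prod_XsubC_eq.
  exact: perm_map_inj.
set E := [pred x | _]; rewrite cardE -ltnS.
apply: leq_trans (max_poly_roots PQ0 _ (enum_uniq E)) _.
  apply/allP => x; rewrite mem_enum inE => /eqP e.
  by rewrite rootE !hornerE !hP e subrr.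
by apply: leq_trans (size_polyD _ _) _; rewrite size_polyN !sP maxnSS.
Qed.

End Fingerprint.

(** * From exact multiset checks to a randomised verifier *)

Section Compile.
Variables (T : Type) (b : nat) (S X : finType).
Variables (next : S -> T + word b -> S) (left right : S -> T + word b -> seq X).

(** An idealised machine that stores both multisets in full; [hash_step] stores only their
    fingerprints at [x]. *)
Definition trace_step (st : S * seq X * seq X) (t : T + word b) :=
  (next st.1.1 t, st.1.2 ++ left st.1.1 t, st.2 ++ right st.1.1 t).

Definition trace (s0 : S) (ts : seq (T + word b)) : S * seq X * seq X :=
  foldl trace_step (s0, [::], [::]) ts.

Variables (F : finFieldType) (code : X -> F).

Definition hash_step (st : F * S * F * F) (t : T + word b) : F * S * F * F :=
  let: (x, s, l, r) := st in
  (x, next s t, l * fingerprint code x (left s t),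
   r * fingerprint code x (right s t))%R.

Lemma foldl_hash_step x s0 ts :
  foldl hash_step (x, s0, 1, 1)%R ts =
  let: (s, l, r) := trace s0 ts in
  (x, s, fingerprint code x l, fingerprint code x r).
Proof.
suff H l r :
    foldl hash_step (x, s0, fingerprint code x l, fingerprint code x r) ts =
    let: (s, l, r) := foldl trace_step (s0, l, r) ts in
    (x, s, fingerprint code x l, fingerprint code x r).
  by rewrite -H /fingerprint big_nil.
elim: ts s0 l r => //= t ts IH s l r.
by rewrite -!fingerprint_cat IH.
Qed.

End Compile.

(** Leaves only a deterministic analysis of [trace]. The memory holds the evaluation point, the
    state and two products, hence the bound by [2 ^ (M * b)]. *)
Lemma fingerprint_protocol (T : Type) (A : eqType) (b : nat) (S X : finType)
    (next : S -> T + word b -> S) (left right : S -> T + word b -> seq X)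
    (s0 : S) (verdict : S -> option A) (k M m : nat) (f : m.-tuple T -> A)
    (len : nat) :
  0 < k -> #|X| <= 2 ^ k -> 2 ^ k * #|S| * 2 ^ k * 2 ^ k <= 2 ^ (M * b) ->
  (forall (s : m.-tuple T) a,
    let: (st, l, r) := trace next left right s0 (transcript s a) in
    3 * maxn (size l) (size r) <= 2 ^ k /\
    forall ans, perm_eq l r -> verdict st = Some ans -> ans = f s) ->
  (forall s : m.-tuple T, exists a, size a <= len /\
    let: (st, l, r) := trace next left right s0 (transcript s a) in
    perm_eq l r /\ verdict st = Some (f s)) ->
  exists V : verifier T A b, mem_words V = M /\ valid_protocol V f len.
Proof.
move=> k0 cX cM traceP helperP.
have [F _ cF] := @pPrimePowerField 2 k isT k0.
have [code code_inj] : exists c : X -> F, injective c.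
  by apply: exists_injective; rewrite cF.
have cC : #|{: k.-tuple bool}| = 2 ^ k by rewrite card_tuple card_bool.
have [pt pt_inj] : exists c : k.-tuple bool -> F, injective c.
  by apply: exists_injective; rewrite cF cC.
pose St := (F * S * F * F)%type.
(* Only the number of memory contents counts, so any injection serves as layout. *)
have [enc enc_inj] : exists c : St -> M.-tuple (word b), injective c.
  apply: exists_injective; rewrite !card_prod cF card_tuple card_tuple card_bool.
  by rewrite -expnM (mulnC b).
have [dec encK] := injective_cancel (0, s0, 0, 0)%R enc_inj.
(* Only the first block of coins is used: it is the evaluation point, which has
   to be kept in memory. *)
pose V := @Verifier T A b M k (fun c => enc (pt c, s0, 1, 1)%R)
  (fun _ t st => enc (hash_step next left right code (dec st) t))
  (fun st => let: (_, s, l, r) := dec st in if l == r then verdict s else None).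
(* The output as a function of the evaluation point, which is uniform in [F]. *)
pose R x s a := let: (s, l, r) := trace next left right s0 (transcript s a) in
  if fingerprint code x l == fingerprint code x r then verdict s else None.
have runE s a (r : random_string V s a) : run r = R (pt r.1) s a.
  case: r => c [cs /= szcs]; rewrite /run /R /=.
  suff -> : foldl (fun x p => enc (hash_step next left right code (dec x) p.2))
      (enc (pt c, s0, 1, 1)%R) (zip cs (transcript s a)) =
      enc (foldl (hash_step next left right code) (pt c, s0, 1, 1)%R
        (transcript s a)).
    by rewrite encK foldl_hash_step; case: trace => [[]].
  move/eqP: szcs; move: (transcript s a) (_, _, _, _) => ts.
  elim: ts cs => [|t ts IH] [|c' cs] st //= [/IH <-].
  by rewrite encK.
have probE s a (p : pred (option A)) :
    prob (fun r : random_string V s a => p (run r)) =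
    prob (fun x : F => p (R x s a)).
  under [fun r => _]funext do rewrite runE.
  rewrite (@prob_fst _ _ (fun c => p (R (pt c) s a))); last first.
    by rewrite card_tuple expn_gt0 cC expn_gt0.
  by rewrite (@prob_inj _ _ pt (fun x => p (R x s a))) ?cF ?cC.
have F0 : (#|F|%:R != 0 :> rat)%R by rewrite pnatr_eq0 cF -lt0n expn_gt0.
have probT (p : pred F) : p =1 predT -> prob p = 1%R.
  by move=> pT; rewrite /prob (eq_card (B := predT)) ?divff.
have valid (s : m.-tuple T) a (l := (trace next left right s0 (transcript s a)).1.2)
    (r := (trace next left right s0 (transcript s a)).2) :
    perm_eq l r ->
    verdict (trace next left right s0 (transcript s a)).1.1 = Some (f s) ->
    valid_annotation V f s a.
  rewrite /l /r /valid_annotation (probE s a (fun o => o == Some (f s))) /R.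
  case: trace => [[st l'] r'] /= lr vst.
  by apply: probT => x; rewrite (perm_fingerprint _ _ lr) eqxx vst eqxx.
exists V; split=> //; split; last first.
  move=> H s; move: (H s) => a.
  have := traceP s a; have := valid s a.
  rewrite (probE s a (fun o => o != None)) /R.
  case: trace => [[st l] r] /= va [lr ans].
  (* Three cases: no verdict, so the output is [None]; equal multisets, so the verdict is right and
     the annotation valid; different multisets, so an answer needs a collision, which at most a
     third of the points give. *)
  case e: (verdict st) va ans => [o|] va ans; last first.
    right; rewrite /prob eq_card0 ?mul0r // => x.
    by rewrite unfold_in; case: ifP.
  have [plr|nplr] := boolP (perm_eq l r).
    by left; apply: va; rewrite // -(ans o).
  right; rewrite /prob.
  rewrite (eq_card (B := [pred x | fingerprint code x l == fingerprint code x r])).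
    have := fingerprint_collisions code_inj nplr => hB.
    rewrite ler_pdivrMr ?ltr0n ?cF ?expn_gt0 // mul1r mulrC ler_pdivlMr ?ltr0n //.
    rewrite -natrM ler_nat mulnC; apply: leq_trans lr.
    by rewrite leq_mul2l hB orbT.
  by move=> x; rewrite !unfold_in /=; case: ifP.
have [H HP] := choice helperP.
exists H => s; last by case: (HP s).
have [_] := HP s; have := valid s (H s).
by case: trace => [[st l] r] /= va [plr e]; apply: va.
Qed.

(** * Acyclic relations and ranks *)

Lemma ranked_acyclic (T : eqType) (e : rel T) (f : T -> nat) :
  (forall x y, e x y -> f x < f y) -> acyclic e.
Proof.
move=> ef [|x p] // /andP[/= exp _].
have : path (relpre f ltn) x (rcons p x) by apply: sub_path exp => y z /ef.
move/order_path_min => /(_ (fun y x z => @ltn_trans (f y) (f x) (f z))).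
by move/allP/(_ x); rewrite mem_rcons mem_head /= ltnn => /(_ isT).
Qed.

(** The rank of [x] is the number of other vertices that reach [x]. Along an edge from [x] to [y] it
    grows: these vertices also reach [y], and [x] is new; by acyclicity [y] does not reach [x]. *)
Lemma acyclic_ranked (T : finType) (e : rel T) : acyclic e ->
  exists f : T -> nat,
    (forall x, f x < #|T|) /\ forall x y, e x y -> f x < f y.
Proof.
move=> ac; have noback x y : e x y -> ~~ connect e y x.
  move=> exy; apply/negP => /connectP[p eyp lxp].
  case: (shortenP eyp) lxp => p' eyp' uyp' _ lxp.
  suff /ac : ucycle e (y :: p') by [].
  by apply/andP; split=> //=; rewrite rcons_path eyp' -lxp.
exists (fun x => #|[pred y | connect e y x && (y != x)]|); split=> [x|x y exy].
  apply: proper_card; apply/properP; split; first by apply/subsetP.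
  by exists x; rewrite // inE eqxx andbF.
apply: proper_card; apply/properP; split.
  apply/subsetP => z; rewrite !inE => /andP[ezx nzx].
  rewrite (connect_trans ezx (connect1 exy)) /=.
  by apply: contraNneq (noback _ _ exy) => <-.
exists x; rewrite !inE ?eqxx ?andbF // connect1 //=.
by apply: contraNneq (noback _ _ exy) => ->; rewrite connect0.
Qed.

(** Serves to list the stream with the edges of a cycle in front. *)
Lemma uniq_perm_cat (T : eqType) (s t : seq T) :
  uniq s -> {subset s <= t} -> exists r, perm_eq t (s ++ r).
Proof.
elim: s t => [|x s IH] t /=; first by exists t.
case/andP=> nxs us st; have xt : x \in t by apply: st; rewrite mem_head.
have [|r tr] := IH (rem x t) us.
  move=> y ys; move: (perm_mem (perm_to_rem xt) y).
  rewrite st inE ?ys ?orbT //; case: eqP => [yx|_ /esym //].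
  by rewrite -yx ys in nxs.
by exists r; rewrite (permPl (perm_to_rem xt)) perm_cons.
Qed.

(** * Two multiset comparisons in one *)

Section Tagged.
Variable Y : eqType.

Definition tagged_by (t : bool) (s : seq (bool * Y)) : seq Y :=
  [seq x.2 | x <- s & x.1 == t].

Lemma tagged_by_cat t s1 s2 :
  tagged_by t (s1 ++ s2) = tagged_by t s1 ++ tagged_by t s2.
Proof. by rewrite /tagged_by filter_cat map_cat. Qed.

Lemma tagged_by_pair t u s :
  tagged_by t (map (pair u) s) = if u == t then s else [::].
Proof.
rewrite /tagged_by; case: (eqVneq u t) => [<-|/negPf ut].
  by elim: s => //= y s IH; rewrite eqxx /= IH.
by elim: s => //= y s IH; rewrite ut.
Qed.

Lemma tagged_by_flatten t ss :
  tagged_by t (flatten ss) = flatten (map (tagged_by t) ss).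
Proof. by rewrite /tagged_by filter_flatten map_flatten -map_comp. Qed.

Lemma perm_tagged s1 s2 : perm_eq s1 s2 <->
  perm_eq (tagged_by true s1) (tagged_by true s2) /\
  perm_eq (tagged_by false s1) (tagged_by false s2).
Proof.
split=> [s12|[st sf]]; first by split; apply/perm_map/perm_filter.
have split s : perm_eq s
    (map (pair true) (tagged_by true s) ++
     map (pair false) (tagged_by false s)).
  rewrite -!map_comp.
  have E t : [seq (pair t \o snd) x | x <- s & x.1 == t] =
      [seq x <- s | x.1 == t].
    by apply: map_id_in => -[u y]; rewrite mem_filter /= => /andP[/eqP <-].
  have /eq_filter Eneg : (fun x : bool * Y => x.1 == false) =1
      predC (fun x => x.1 == true).
    by case=> [[]].
  by rewrite !E Eneg perm_sym perm_filterC.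
rewrite (permPl (split s1)) (permPr (split s2)).
exact: perm_cat (perm_map _ st) (perm_map _ sf).
Qed.

End Tagged.

(** * Checks on the chunks of an annotation *)

Section Chunks.
Variables (W : finType) (num : W -> nat).
Hypothesis num_inj : injective num.

Definition chunk : Type := ((W * W) * (W * W)) * ((W * W) * (W * W)).
Implicit Types (c : chunk) (cs : seq chunk).

Definition chunk_edge c : W * W := (c.1.1.1, c.1.2.1).
Definition claims c : seq (W * W) := [:: c.1.1; c.1.2].
Definition listed c : seq (W * W) := [:: c.2.1; c.2.2].
Definition increasing c : bool := num c.1.1.2 < num c.1.2.2.

(** Pairs with the same vertex and different ranks are incomparable, so a sorted list gives each
    vertex a single rank. *)
Definition list_le (p q : W * W) : bool := (num p.1 < num q.1) || (p == q).

Lemma list_le_trans : transitive list_le.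
Proof.
move=> q p r; rewrite /list_le => /orP[pq|/eqP-> //] /orP[qr|/eqP<-].
  by rewrite (ltn_trans pq qr).
by rewrite pq.
Qed.

Lemma list_le_functional s : sorted list_le s ->
  {in s &, forall p q, p.1 = q.1 -> p = q}.
Proof.
rewrite (sorted_pairwise list_le_trans); elim: s => //= x s IH /andP[/allP xs /IH {}IH].
have H q : q \in s -> x.1 = q.1 -> x = q.
  by move=> /xs /orP[lt e|/eqP //]; rewrite e ltnn in lt.
move=> p q; rewrite !inE => /orP[/eqP->|ps] /orP[/eqP->|qs] //.
- exact: H.
- by move=> /esym /(H _ ps).
- exact: IH.
Qed.

Definition list_step (st : bool * option (W * W)) (p : W * W) :=
  (st.1 && oapp (fun l => list_le l p) true st.2, Some p).

Definition dag_step (st : bool * option (W * W)) c :=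
  let: (ok, l) := foldl list_step st (listed c) in (ok && increasing c, l).

Lemma foldl_dag_step cs : (foldl dag_step (true, None) cs).1 =
  all increasing cs && sorted list_le (flatten (map listed cs)).
Proof.
pose D (l : option (W * W)) := if l is Some p then path list_le p else sorted list_le.
(* Generalised to any state: [D l] says that the list may follow the last pair [l]. *)
rewrite -[RHS]andTb -[sorted _]/(D None).
elim: cs true None => [|c cs IH] ok l /=; first by case: l => [l|]; rewrite andbT.
rewrite /dag_step /= IH; case: l => [l|] /=; rewrite ?andbT.
  by case: ok; case: (increasing c); case: (list_le l _); case: (list_le _ _);
    rewrite ?andbF.
by case: ok; case: (increasing c); case: (list_le _ _); rewrite ?andbF.
Qed.

Definition walk : Type := option (W * W) + bool.

(* [inl (Some (s, x))] is a walk from [s] that has reached [x] and not yet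
   returned to [s]; [inr true] is a closed walk, possibly followed by arbitrary
   edges, and [inr false] a failure. *)
Definition walk_step (st : walk) (e : W * W) : walk :=
  match st with
  | inl None => if e.2 == e.1 then inr true else inl (Some e)
  | inl (Some (s, x)) =>
      if e.1 == x then if e.2 == s then inr true else inl (Some (s, e.2))
      else inr false
  | inr d => inr d
  end.

(** An open walk from [s] to [x] satisfies [g s < g x], so closing it would give [g s < g s]. *)
Lemma walk_increasing (g : W -> nat) es :
  {in es, forall e, g e.1 < g e.2} -> foldl walk_step (inl None) es != inr true.
Proof.
pose good st := match st : walk with
  | inl None => true | inl (Some (s, x)) => g s < g x | inr d => ~~ d end.
move=> ges; suff: good (foldl walk_step (inl None) es) by case: foldl => [|[]].
have: good (inl None) by [].
elim: es (inl None : walk) ges => //= e es IH st ges gst; apply: IH.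
  by move=> e' es_e'; apply: ges; rewrite inE es_e' orbT.
have ge : g e.1 < g e.2 by apply: ges; rewrite mem_head.
case: st gst => [[[s x]|]|d] //= gst; last first.
  by case: eqP ge => [->|_] /=; rewrite ?ltnn //; case: e {ges}.
case: eqP => //= ex; rewrite ex in ge.
case: eqP => [es'|_]; last exact: ltn_trans ge.
by rewrite es' in ge; have := ltn_trans gst ge; rewrite ltnn.
Qed.

Lemma foldl_walk_done es : foldl walk_step (inr true) es = inr true.
Proof. by elim: es. Qed.

Lemma walk_cycle x p es : uniq (x :: p) ->
  foldl walk_step (inl None) (pairmap pair x (rcons p x) ++ es) = inr true.
Proof.
have H s y q : s \notin q -> 
    foldl walk_step (inl (Some (s, y))) (pairmap pair y (rcons q s) ++ es) = inr true.
  elim: q y => [|z q IH] y /=; first by rewrite !eqxx foldl_walk_done.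
  by rewrite inE negb_or eq_sym => /andP[/negPf -> sq]; rewrite eqxx; apply: IH.
case: p => [|y p] /=; first by rewrite eqxx foldl_walk_done.
by rewrite inE negb_or eq_sym => /andP[/andP[/negPf -> xp] _]; apply: H.
Qed.


Definition chunk_list_rank (ps : seq (W * W)) (x : W) : nat :=
  num (nth (x, x) ps (find (fun p => p.1 == x) ps)).2.

Lemma chunk_list_rankE ps p : {in ps &, forall p q, p.1 = q.1 -> p = q} ->
  p \in ps -> chunk_list_rank ps p.1 = num p.2.
Proof.
move=> ps_fun pps; rewrite /chunk_list_rank.
have hp : has (fun q => q.1 == p.1) ps by apply/hasP; exists p.
congr (num _.2); apply: ps_fun => //; first by rewrite mem_nth -?has_find.
exact/eqP/(nth_find (p.1, p.1) hp).
Qed.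

(** The permutation puts every claim into the sorted list, where a vertex has one rank. The claimed
    increases are thus increases of one function. *)
Lemma dag_sound cs :
  perm_eq (flatten (map claims cs)) (flatten (map listed cs)) ->
  (foldl dag_step (true, None) cs).1 ->
  exists g : W -> nat, {in map chunk_edge cs, forall e, g e.1 < g e.2}.
Proof.
move=> cl; rewrite foldl_dag_step => /andP[/allP inc /list_le_functional ps_fun].
exists (chunk_list_rank (flatten (map listed cs))) => _ /mapP[c c_cs ->] /=.
have mem p : p \in claims c -> p \in flatten (map listed cs).
  move=> pc; rewrite -(perm_mem cl); apply/flattenP.
  by exists (claims c); rewrite ?map_f.
rewrite !(chunk_list_rankE ps_fun (mem _ _)) ?inE ?eqxx ?orbT //.
exact: inc.
Qed.

Variable rk : W -> W.

Definition ranked (es : seq (W * W)) : seq (W * W) :=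
  flatten [seq [:: (e.1, rk e.1); (e.2, rk e.2)] | e <- es].

Fixpoint chunks_of (es ps : seq (W * W)) : seq chunk :=
  match es, ps with
  | e :: es', p :: q :: ps' =>
      ((e.1, rk e.1), (e.2, rk e.2), (p, q)) :: chunks_of es' ps'
  | _, _ => [::]
  end.

Lemma chunks_ofP es ps : size ps = (size es).*2 ->
  [/\ map chunk_edge (chunks_of es ps) = es,
      flatten (map claims (chunks_of es ps)) = ranked es,
      flatten (map listed (chunks_of es ps)) = ps &
      all increasing (chunks_of es ps) =
        all (fun e => num (rk e.1) < num (rk e.2)) es].
Proof.
rewrite /ranked; elim: es ps => [|[u v] es IH] [|p [|q ps]] //= [/IH[e1 e2 e3 e4]].
by rewrite e1 e2 e3 e4.
Qed.

(** The honest annotation: the further pairs are the claims sorted by vertex. *)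
Lemma chunks_exist es : exists cs,
  [/\ map chunk_edge cs = es,
      perm_eq (flatten (map claims cs)) (flatten (map listed cs)) &
      {in es, forall e, num (rk e.1) < num (rk e.2)} ->
      (foldl dag_step (true, None) cs).1].
Proof.
pose le : rel (W * W) := relpre (num \o fst) leq.
have szr : size (ranked es) = (size es).*2.
  by rewrite /ranked; elim: es => //= e es ->.
exists (chunks_of es (sort le (ranked es))).
have [|e1 e2 e3 e4] := @chunks_ofP es (sort le (ranked es)).
  by rewrite size_sort.
split; rewrite ?e2 ?e3 ?perm_sort // 1?perm_sym ?perm_sort //.
move=> /allP inc; rewrite foldl_dag_step e4 e3 inc.
(* Equal vertices carry equal ranks here, so the weak order used for sorting implies [list_le]. *)
have rankedP : {in ranked es, forall p, p.2 = rk p.1}.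
  by move=> p /flattenP[_ /mapP[e _ ->]]; rewrite !inE => /orP[] /eqP->.
apply: (@sub_in_sorted _ (mem (ranked es)) le).
- move=> p q /rankedP ep /rankedP eq; rewrite /le /list_le /= leq_eqVlt.
  case/orP => [/eqP /num_inj e|->//]; apply/orP; right; apply/eqP.
  by rewrite [p]surjective_pairing [q]surjective_pairing ep eq e.
- by apply/allP => p; rewrite mem_sort.
- by apply: sort_sorted => p q; apply: leq_total.
Qed.

End Chunks.

(** * Words as numbers *)

Section Words.
Variable b : nat.

Definition num (x : word b) : nat := index x (enum {: word b}).
Definition word_of (i : nat) : word b :=
  nth [tuple of nseq b false] (enum {: word b}) i.

Lemma num_inj : injective num.
Proof.
by apply: (can_inj (g := word_of)) => x; rewrite /word_of nth_index ?mem_enum.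
Qed.

Lemma word_ofK i : i < 2 ^ b -> num (word_of i) = i.
Proof.
by move=> ib; rewrite /num index_uniq ?enum_uniq // -cardE card_tuple card_bool.
Qed.

End Words.

(** * The states of the verifier and its run on an annotation *)

Section Machine.
Variables (n m b : nat).
Notation W := (word b).
Notation token := (edge n + W)%type.
Notation chunk := (chunk W).

(** A shift register for seven words: a chunk has eight, and the eighth completes it on arrival.
    Emptying it after each chunk keeps the chunks aligned. *)
Definition buffer : Type :=
  option W * option W * option W * option W * option W * option W * option W.

Definition empty_buffer : buffer := (None, None, None, None, None, None, None).

Definition push (bf : buffer) (x : W) : buffer :=
  let: (_, a2, a3, a4, a5, a6, a7) := bf in (a2, a3, a4, a5, a6, a7, Some x).

Definition completed (bf : buffer) (x : W) : option chunk :=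
  if bf is (Some a1, Some a2, Some a3, Some a4, Some a5, Some a6, Some a7)
  then Some ((a1, a2), (a3, a4), ((a5, a6), (a7, x))) else None.

Definition chunk_words (c : chunk) : seq W :=
  let: ((a1, a2), (a3, a4), ((a5, a6), (a7, a8))) := c in
  [:: a1; a2; a3; a4; a5; a6; a7; a8].

Definition state : Type :=
  'I_m.+1 * buffer * (bool * option (W * W)) * (option (W * W) + bool).

Definition start : state := (ord0, empty_buffer, (true, None), inl None).

(* Chunks after the first [m] are ignored, which keeps the multisets small. *)
Definition new_chunk (st : state) (t : token) : option chunk :=
  if t is inr x then if st.1.1.1 < m then completed st.1.1.2 x else None
  else None.

Definition next (st : state) (t : token) : state :=
  let: (i, bf, dg, wk) := st in
  match new_chunk st t, t with
  | Some c, _ => (inord i.+1, empty_buffer, dag_step (@num b) dg c,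
                  walk_step wk (chunk_edge c))
  | None, inr x => (i, push bf x, dg, wk)
  | None, inl _ => st
  end.

Definition vertex_word (x : 'I_n) : W := word_of b x.
Definition edge_words (e : edge n) : W * W := (vertex_word e.1, vertex_word e.2).

(** Tag [true] compares the stream with the annotated edges, tag [false] the claims with the further
    pairs. *)
Definition left_chunk (c : chunk) : seq (bool * (W * W)) := map (pair false) (claims c).
Definition right_chunk (c : chunk) : seq (bool * (W * W)) :=
  (true, chunk_edge c) :: map (pair false) (listed c).

Definition left_items (st : state) (t : token) : seq (bool * (W * W)) :=
  if t is inl e then [:: (true, edge_words e)]
  else oapp left_chunk [::] (new_chunk st t).

Definition right_items (st : state) (t : token) : seq (bool * (W * W)) :=
  oapp right_chunk [::] (new_chunk st t).

Definition verdict (st : state) : option bool :=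
  if st.2 == inr true then Some false
  else if st.1.2.1 then Some true else None.

Definition stream_items (s : seq (edge n)) : seq (bool * (W * W)) :=
  map (pair true) (map edge_words s).

(** Closed form of the trace once the stream [s] and the chunks [cs] are read, with [bf] pending. *)
Definition after (s : seq (edge n)) (cs : seq chunk) (bf : buffer) :
    state * seq (bool * (W * W)) * seq (bool * (W * W)) :=
  ((inord (size cs), bf, foldl (dag_step (@num b)) (true, None) cs,
    foldl (@walk_step _) (inl None) (map (@chunk_edge _) cs)),
   stream_items s ++ flatten (map left_chunk cs),
   flatten (map right_chunk cs)).

Notation tstep := (trace_step next left_items right_items).
Notation run_trace := (trace next left_items right_items start).

Lemma trace_stream s : run_trace (map inl s) = after s [::] empty_buffer.
Proof.
have -> : after s [::] empty_buffer = (start, stream_items s, [::]).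
  by rewrite /after /= cats0 /start -[in RHS](inord_val ord0).
elim/last_ind: s => // s e; rewrite /trace map_rcons foldl_rcons => ->.
by rewrite /trace_step /= /stream_items !map_rcons cats1.
Qed.

Lemma step_after s cs bf x : size cs <= m ->
  tstep (after s cs bf) (inr x) =
  if (size cs < m, completed bf x) is (true, Some c)
  then after s (rcons cs c) empty_buffer else after s cs (push bf x).
Proof.
move=> csm; rewrite /trace_step /after /= /right_items /= inordK ?ltnS //.
case: ltnP => _ /=; last by rewrite ?cats0.
case: (completed bf x) => [c|] /=; last by rewrite ?cats0.
by rewrite size_rcons !map_rcons !foldl_rcons -!cats1 !flatten_cat /= catA.
Qed.

(** Even a dishonest annotation parses into at most [m] chunks, so soundness can be checked on
    [after]. *)
Lemma trace_after s a : exists cs bf, size cs <= m /\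
  run_trace (transcript s a) = after s cs bf.
Proof.
elim/last_ind: a => [|a x [cs [bf [csm e]]]].
  by exists [::], empty_buffer; rewrite /transcript cats0 trace_stream.
rewrite /transcript map_rcons -rcons_cat /trace foldl_rcons.
rewrite -/(trace _ _ _ _ _) -/(transcript s a) e.
rewrite step_after //; case: ltnP => [lt|_]; last by exists cs, (push bf x).
case: (completed bf x) => [c|]; last by exists cs, (push bf x).
by exists (rcons cs c), empty_buffer; rewrite size_rcons.
Qed.

Lemma trace_chunks s cs : size cs <= m ->
  run_trace (transcript s (flatten (map chunk_words cs))) = after s cs empty_buffer.
Proof.
elim/last_ind: cs => [|cs c IH]; first by rewrite /transcript cats0 trace_stream.
rewrite size_rcons => csm.
have -> : transcript s (flatten (map chunk_words (rcons cs c))) =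
    transcript s (flatten (map chunk_words cs)) ++ map inr (chunk_words c).
  by rewrite /transcript map_rcons flatten_rcons map_cat catA.
rewrite /trace foldl_cat -/(trace _ _ _ _ _) (IH (ltnW csm)).
case: c => [[[a1 a2] [a3 a4]] [[a5 a6] [a7 a8]]] /=.
by do !rewrite step_after ?(ltnW csm) // csm /=.
Qed.

Lemma size_items s cs bf : size s = m -> size cs <= m ->
  maxn (size (after s cs bf).1.2) (size (after s cs bf).2) <= 3 * m.
Proof.
move=> sm csm; rewrite /after /= /stream_items size_cat !size_map sm.
have -> : size (flatten (map left_chunk cs)) = 2 * size cs.
  by elim: cs {csm} => //= c cs; lia.
have -> : size (flatten (map right_chunk cs)) = 3 * size cs.
  by elim: cs {csm} => //= c cs; lia.
lia.
Qed.

Lemma perm_items s cs bf :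
  perm_eq (after s cs bf).1.2 (after s cs bf).2 <->
    perm_eq (map edge_words s) (map (@chunk_edge _) cs) /\
    perm_eq (flatten (map (@claims _) cs)) (flatten (map (@listed _) cs)).
Proof.
rewrite /after /stream_items; apply: iff_trans (perm_tagged _ _) _.
rewrite !tagged_by_cat !tagged_by_pair /= !tagged_by_flatten -!map_comp /comp /=.
have E1 : flatten [seq tagged_by true (left_chunk c) | c <- cs] = [::].
  by elim: (cs) => //= c cs' ->.
have E2 : flatten [seq tagged_by true (right_chunk c) | c <- cs] =
    map (@chunk_edge _) cs.
  by elim: (cs) => //= c cs' ->.
have E3 : flatten [seq tagged_by false (left_chunk c) | c <- cs] =
    flatten (map (@claims _) cs).
  by elim: (cs) => //= c cs' ->.
have E4 : flatten [seq tagged_by false (right_chunk c) | c <- cs] =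
    flatten (map (@listed _) cs).
  by elim: (cs) => //= c cs' ->.
by rewrite E1 E2 E3 E4 cats0.
Qed.

Lemma verdict_sound s cs bf ans : n <= 2 ^ b ->
  perm_eq (after s cs bf).1.2 (after s cs bf).2 ->
  verdict (after s cs bf).1.1 = Some ans -> ans = is_dag s.
Proof.
move=> nb /perm_items[es cl]; rewrite /verdict /after /=.
case: eqP => [wk [<-]|_].
  apply/esym/asboolPn => ac; have [f [_ fP]] := acyclic_ranked ac.
  (* The rank carried over to words, with value 0 on words that name no node; it rules out a closed
     walk. *)
  pose g (x : W) := oapp f 0 (insub (num x)).
  have gP x : g (vertex_word x) = f x.
    rewrite /g /vertex_word word_ofK ?(leq_trans (ltn_ord x)) //.
    by rewrite valK.
  have /walk_increasing : {in map (@chunk_edge _) cs, forall e, g e.1 < g e.2}.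
    move=> e; rewrite -(perm_mem es) => /mapP[[x y] xy ->] /=.
    by rewrite !gP; apply: fP.
  by rewrite wk eqxx.
case: ifP => // ok [<-]; apply/esym/asboolP.
have [g gP] := dag_sound cl ok.
apply: (@ranked_acyclic _ _ (g \o vertex_word)) => x y xy.
by apply: (gP (edge_words (x, y))); rewrite -(perm_mem es) map_f.
Qed.

Lemma verdict_complete s : n <= 2 ^ b -> size s = m -> exists cs,
  [/\ size cs = m,
      perm_eq (after s cs empty_buffer).1.2 (after s cs empty_buffer).2 &
      verdict (after s cs empty_buffer).1.1 = Some (is_dag s)].
Proof.
move=> nb sm.
have vwK (x : 'I_n) : num (vertex_word x) = x.
  by rewrite word_ofK ?(leq_trans (ltn_ord x)).
suff [es [rk [pes dgP]]] : exists es (rk : W -> W), perm_eq (map edge_words s) es /\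
    if is_dag s then {in es, forall e, num (rk e.1) < num (rk e.2)}
    else foldl (@walk_step _) (inl None) es = inr true.
  have [cs [e cl inc]] := chunks_exist (@num_inj b) rk es.
  have lr : perm_eq (after s cs empty_buffer).1.2 (after s cs empty_buffer).2.
    by apply/perm_items; rewrite e.
  exists cs; split=> //.
    by rewrite -(size_map (@chunk_edge _)) e -(perm_size pes) size_map.
  (* Some answer is enough, since [verdict_sound] makes it the right one. *)
  suff [ans vst] : exists ans, verdict (after s cs empty_buffer).1.1 = Some ans.
    by rewrite vst (verdict_sound nb lr vst).
  rewrite /verdict /after /= e.
  case: eqP => [_|nwk]; first by exists false.
  by case: ifP dgP => [_ /inc ->|_ /nwk//]; exists true.
have [dg|/asboolPn ndg] := boolP (is_dag s).
  have [f [fn fP]] := acyclic_ranked (asboolP _ dg).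
  (* Ranks are below [n <= 2 ^ b], so each fits in a word. *)
  pose f' i := oapp f 0 (insub i).
  have rkP (x : 'I_n) : num (word_of b (f' (num (vertex_word x)))) = f x.
    by rewrite vwK /f' valK /= word_ofK // (leq_trans (fn x)) // card_ord.
  exists (map edge_words s), (fun u => word_of b (f' (num u))); split=> //.
  by move=> _ /mapP[[x y] xy ->] /=; rewrite !rkP; apply: fP.
have [[|x p] xp //] : exists2 c, ucycle (stream_graph s) c & c <> [::].
  apply: contrapT => nc; apply: ndg => c uc; apply: contrapT => c0.
  by apply: nc; exists c.
move=> _; move/andP: xp => [/= cyc uxp].
(* The edges of a simple cycle are distinct because their sources are. *)
have us : uniq (pairmap pair x (rcons p x)).
  have H (z : 'I_n) q : map fst (pairmap pair z q) = belast z q.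
    by elim: q z => //= y q IH z; rewrite IH.
  by apply: (@map_uniq _ _ fst); rewrite H belast_rcons.
have sub : {subset pairmap pair x (rcons p x) <= s}.
  move: cyc; move: (rcons p x) => q.
  elim: q (x) => [|y q IH] z //= /andP[zy yq] e.
  by rewrite inE => /orP[/eqP->|/(IH _ yq)].
have [r pr] := uniq_perm_cat us sub.
(* Both permutations hold whatever ranks are claimed, so [id] serves. *)
exists (map edge_words (pairmap pair x (rcons p x) ++ r)), id.
split; first exact: perm_map.
have vw_inj : injective vertex_word.
  by move=> y z e; apply: val_inj; rewrite /= -!vwK e.
rewrite map_cat.
have -> : map edge_words (pairmap pair x (rcons p x)) =
    pairmap pair (vertex_word x) (rcons (map vertex_word p) (vertex_word x)).
  rewrite -map_rcons; move: (rcons p x) => q.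
  by elim: q (x) => //= y q IH z; rewrite IH.
by apply: walk_cycle; rewrite -map_cons map_inj_uniq.
Qed.

(** In words: [c] for the counter, 2 for each of the seven buffer cells, 4 for the rank check and 4
    for the walk. *)
Lemma card_state_le c :
  0 < b -> m.+2 <= 2 ^ (c * b) -> #|{: state}| <= 2 ^ ((c + 22) * b).
Proof.
move=> b0 mc; rewrite !(card_prod, card_sum, card_option, card_bool, card_ord).
rewrite !(card_tuple, card_bool).
set B := 2 ^ b; have B2 : 2 <= B by rewrite -[X in X <= _]expn1 leq_pexp2l.
have o1 : B.+1 <= B ^ 2 by rewrite expnS expn1; nia.
have o2 : (B * B).+1 <= B ^ 3 by rewrite !expnS expn0; nia.
have o3 : (B * B).+1 + 2 <= B ^ 4.
  by apply: (@leq_trans (B ^ 3 * B)); [nia|rewrite !expnS expn0; nia].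
have -> : 2 ^ ((c + 22) * b) = 2 ^ (c * b) *
    (B ^ 2 * B ^ 2 * B ^ 2 * B ^ 2 * B ^ 2 * B ^ 2 * B ^ 2)
    * (B * B ^ 3) * B ^ 4.
  by rewrite /B -!expnM -!expnD; congr (_ ^ _); lia.
by rewrite !leq_mul // ltnW.
Qed.

(** Three field elements of [c + 4] words and a state of [c + 22] words make [4 * c + 34]; [m]
    chunks of eight words make [8 * m]. *)
Lemma dag_protocol c : 0 < b -> m.+2 <= 2 ^ (c * b) -> n <= 2 ^ b ->
  exists V : verifier (edge n) bool b, mem_words V = 4 * c + 34 /\
    valid_protocol V (fun s : m.-tuple (edge n) => is_dag s) (8 * m).
Proof.
move=> b0 mc nb; pose k := (c + 4) * b.
(* The factor 9 is below [2 ^ 4], which the four extra words in [k] absorb. *)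
have mk : 3 * (3 * m) <= 2 ^ k.
  apply: (@leq_trans (2 ^ 4 * m.+2)); first lia.
  rewrite /k mulnDl expnD mulnC leq_mul // leq_exp2l //; lia.
apply: (@fingerprint_protocol _ _ _ state (bool * (W * W))%type
  next left_items right_items start verdict k).
- by rewrite muln_gt0 b0 addnS.
- rewrite !card_prod card_bool card_tuple card_bool -[X in X * _]expn1 -!expnD.
  by rewrite leq_exp2l // /k; lia.
- apply: leq_trans (_ : 2 ^ k * 2 ^ ((c + 22) * b) * 2 ^ k * 2 ^ k <= _).
    by rewrite !leq_mul // card_state_le.
  by rewrite -!expnD leq_exp2l // /k; lia.
- move=> s a; have [cs [bf [csm e]]] := trace_after s a.
  have := size_items bf (size_tuple s) csm; have := @verdict_sound s cs bf.
  rewrite e; case: (after s cs bf) => [[st l] r] /= vs sz.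
  split; first by apply: leq_trans mk; rewrite leq_mul2l.
  by move=> ans lr; apply: vs.
- move=> s; have [cs [csm lr vst]] := verdict_complete nb (size_tuple s).
  exists (flatten (map chunk_words cs)); split.
    rewrite -csm; elim: (cs) => //= -[[[a1 a2] [a3 a4]] [[a5 a6] [a7 a8]]] cs' IH.
    by rewrite /= mulnS !ltnS.
  by rewrite trace_chunks ?csm.
Qed.

End Machine.

Theorem theorem1 (w : nat -> nat) (hw : theta_log w) :
  exists P : forall n m : nat, verifier (edge n) bool (w m),
    hv_protocol is_dag (fun n m => m) (fun n m => 1) P.
Proof.
have [c1 [c2 cP]] := hw.
have w0 m : 0 < w m.
  have [+ _] := cP m; case: (w m) => // /[!muln0] /[!leqn0] /eqP e.
  by have := @trunc_log_ltn 2 m.+2 isT; rewrite e.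
(* Rounding in [trunc_log] costs one bit, covered by one more positive [w m]. *)
have mw m : m.+2 <= 2 ^ (c1.+1 * w m).
  apply: leq_trans (ltnW (@trunc_log_ltn 2 m.+2 isT)) _.
  by rewrite leq_exp2l // mulSn -addn1 addnC leq_add // (cP m).1.
have PP n m : exists V : verifier (edge n) bool (w m), n <= 2 ^ w m ->
    mem_words V = 4 * c1.+1 + 34 /\
    valid_protocol V (fun s : m.-tuple (edge n) => is_dag s) (8 * m).
  have [nb|_] := leqP n (2 ^ w m).
    by have [V VP] := dag_protocol (w0 m) (mw m) nb; exists V.
  (* If node names do not fit in a word, nothing is claimed and a trivial verifier does. *)
  by exists (@Verifier _ _ _ 0 0
    (fun _ => [tuple]) (fun _ _ s => s) (fun _ => None)).
(* This constant bounds the memory and also exceeds the 8 of the annotation length. *)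
exists (fun n m => projT1 (cid (PP n m))); exists (4 * c1.+1 + 34) => n m nb.
case: (cid _) => V /= /(_ nb)[-> [[H Hv Hs] Vs]]; split; first by lia.
by split=> //; exists H => // s; apply: leq_trans (Hs s) _; lia.
Qed.
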